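(* For all integers $k\ge2$ and $m,n\ge0$, $N_k(m,n)\ge N_k(m+2,n)$.
   Context: $(a;q)_n=\prod_{0\le j<n}(1-aq^j)$ and $(a,b;q)_n=(a;q)_n(b;q)_n$. For $k\ge2$ the Garvan $k$-rank counts $N_k(m,n)$ are defined by the formal expansion (power series in $q$ with Laurent polynomial coefficients in $x$) $$\sum_{n\ge0}\sum_{m\in\mathbb{Z}}N_k(m,n)x^mq^n=\sum_{n_{k-1}\ge n_{k-2}\ge\cdots\ge n_1\ge0}\frac{q^{n_1^2+n_2^2+\cdots+n_{k-1}^2}}{(q;q)_{n_{k-1}-n_{k-2}}\cdots(q;q)_{n_2-n_1}(xq,x^{-1}q;q)_{n_1}}.$$ *)

(* Defs.v *)
From HB Require Import structures.
From mathcomp Require Import all_boot all_order all_algebra.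
From mathcomp Require Import finmap.
From mathcomp.multinomials Require Import monalg.

Set Implicit Arguments.
Unset Strict Implicit.
Unset Printing Implicit Defensive.

Import GRing.Theory.

Local Open Scope ring_scope.

(* The ring Z[x, x^-1]: finitely supported functions int -> int, where
   << c *g i >> is c x^i and f@_i is the coefficient of x^i in f.  monalg only
   puts a ring structure on {malg R[K]} for monoids K without nontrivial
   invertible elements, so the one for K = int (additively) is built here. *)
Definition laurent : Type := {malg int[int]}.

HB.instance Definition _ := GRing.Zmodule.copy laurent {malg int[int]}.

Section LaurentRing.
Implicit Types (f g h : laurent) (i j c d : int).

Definition lmul f g : laurent :=
  \sum_(i <- msupp f) \sum_(j <- msupp g) << f@_i * g@_j *g i + j >>.

Definition lone : laurent := << 1 *g 0 >>.

Lemma lmulw (D E : {fset int}) f g :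
  (msupp f `<=` D)%fset -> (msupp g `<=` E)%fset ->
  lmul f g = \sum_(i <- D) \sum_(j <- E) << f@_i * g@_j *g i + j >>.
Proof.
move=> leD leE; rewrite /lmul (big_fset_incl _ leD) /=.
  apply/eq_bigr=> i _; apply/big_fset_incl => // j _ /mcoeff_outdom ->.
  by rewrite mulr0 monalgU0.
move=> i _ /mcoeff_outdom fi.
by rewrite big1 // => j _; rewrite fi mul0r monalgU0.
Qed.

Lemma lmulC : commutative lmul.
Proof.
move=> f g; rewrite /lmul exchange_big /=.
by apply: eq_bigr => i _; apply: eq_bigr => j _; rewrite mulrC addrC.
Qed.

Lemma lmul0 : left_zero 0 lmul.
Proof. by move=> f; rewrite /lmul msupp0 big_seq_fset0. Qed.

Lemma lmulr0 : right_zero 0 lmul.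
Proof. by move=> f; rewrite lmulC lmul0. Qed.

Lemma lmulDl : left_distributive lmul +%R.
Proof.
move=> f g h; rewrite (lmulw (msuppD_le f g) (fsubset_refl _)).
rewrite (lmulw (fsubsetUl (msupp f) (msupp g)) (fsubset_refl (msupp h))).
rewrite (lmulw (fsubsetUr (msupp f) (msupp g)) (fsubset_refl (msupp h))).
rewrite -big_split /=; apply/eq_bigr=> i _.
rewrite -big_split /=; apply/eq_bigr=> j _.
by rewrite mcoeffD mulrDl monalgUD.
Qed.

Lemma lmulDr : right_distributive lmul +%R.
Proof. by move=> f g h; rewrite lmulC lmulDl !(lmulC f). Qed.

Lemma lmulUU c d i j :
  lmul << c *g i >> << d *g j >> = << c * d *g i + j >>.
Proof. by rewrite (lmulw msuppU_le msuppU_le) !big_seq_fset1 !mcoeffUU. Qed.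

Lemma laurent_ind (P : laurent -> Prop) :
  P 0 -> (forall c i, P << c *g i >>) ->
  (forall f g, P f -> P g -> P (f + g)) -> forall f, P f.
Proof. by move=> P0 PU PD f; rewrite (monalgE f); elim/big_ind: _. Qed.

Lemma lmul1 : left_id lone lmul.
Proof.
elim/laurent_ind => [|c i|f g IHf IHg]; first exact: lmulr0.
  by rewrite lmulUU mul1r add0r.
by rewrite lmulDr IHf IHg.
Qed.

Lemma lmulA : associative lmul.
Proof.
move=> f g h; elim/laurent_ind: f => [|c i|f f' IHf IHf'].
- by rewrite !lmul0.
- elim/laurent_ind: g => [|d j|g g' IHg IHg'].
  + by rewrite !(lmul0, lmulr0).
  + elim/laurent_ind: h => [|e k|h h' IHh IHh'].
    * by rewrite !lmulr0.
    * by rewrite !lmulUU mulrA addrA.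
    * by rewrite !lmulDr IHh IHh'.
  + by rewrite lmulDl !lmulDr lmulDl IHg IHg'.
- by rewrite !lmulDl IHf IHf'.
Qed.

Lemma lone_neq0 : lone != 0.
Proof. by rewrite monalgU_eq0. Qed.

End LaurentRing.

HB.instance Definition _ := GRing.Zmodule_isComNzRing.Build laurent
  lmulA lmulC lmul1 lmulDl lone_neq0.

Definition lX (i : int) : laurent := << 1 *g i >>.

(* The coefficient of q^n (q being 'X) in the power series expansion of p / d,
   where d has constant coefficient 1 and so 1 / d is the sum of (1 - d)^i over
   i >= 0; only i <= n contribute. *)
Definition fps_div (R : comNzRingType) (p d : {poly R}) (n : nat) : R :=
  (p * \sum_(i < n.+1) (1 - d) ^+ i)`_n.

Lemma coef_mul_exp (R : comNzRingType) (p d : {poly R}) (m n : nat) :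
  d`_0 = 0 -> (n < m)%N -> (p * d ^+ m)`_n = 0.
Proof.
move=> d0; elim: m n => // m IHm n lt_nm.
rewrite exprSr mulrA coefM big_ord_recr /= subnn d0 mulr0 addr0.
by apply: big1 => i _; rewrite IHm ?mul0r //; apply: leq_trans (ltn_ord i) _.
Qed.

Lemma fps_divP (R : comNzRingType) (p d : {poly R}) (n : nat) :
  d`_0 = 1 -> \sum_(i < n.+1) d`_i * fps_div p d (n - i) = p`_n.
Proof.
move=> d0.
have e0 : (1 - d)`_0 = 0 by rewrite coefB coef1 d0 subrr.
pose F m := \sum_(i < m) (1 - d) ^+ i.
have stab l m : (l < m)%N -> (p * F m)`_l = fps_div p d l.
  move=> lt_lm; rewrite /fps_div -[RHS]/((p * F l.+1)`_l).
  elim: m lt_lm => // m IHm; rewrite ltnS leq_eqVlt => /orP[/eqP-> //|lt_lm].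
  by rewrite /F big_ord_recr /= mulrDr coefD coef_mul_exp // addr0 IHm.
have -> : \sum_(i < n.+1) d`_i * fps_div p d (n - i) = (d * (p * F n.+1))`_n.
  rewrite coefM; apply: eq_bigr => i _.
  by rewrite stab // ltnS leq_subr.
have -> : d * (p * F n.+1) = p - p * (1 - d) ^+ n.+1.
  have -> : (1 - d) ^+ n.+1 = 1 - d * F n.+1.
    by rewrite -[LHS](subrK 1) subrX1 addrAC subrr add0r mulNr addrC.
  by rewrite mulrBr mulr1 subKr mulrCA.
by rewrite coefB coef_mul_exp // subr0.
Qed.

Definition qpoch (R : comNzRingType) (a : {poly R}) (n : nat) : {poly R} :=
  \prod_(0 <= j < n) (1 - a * 'X^j).

(* The summand indexed by s = [:: n_1; ...; n_(k-1)], so n_(i+1) = s`_i. *)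
Definition garvan_num (s : seq nat) : {poly laurent} :=
  'X^(\sum_(i <- s) i ^ 2).

Definition garvan_den (s : seq nat) : {poly laurent} :=
  (\prod_(0 <= i < (size s).-1) qpoch 'X (nth 0 s i.+1 - nth 0 s i)) *
  qpoch ((lX 1)%:P * 'X) (nth 0 s 0) * qpoch ((lX (-1))%:P * 'X) (nth 0 s 0).

Lemma qpoch_coef0 (R : comNzRingType) (a : {poly R}) (n : nat) :
  a`_0 = 0 -> (qpoch a n)`_0 = 1.
Proof.
move=> a0; rewrite /qpoch; elim/big_ind: _ => [|p r p0 r0|j _].
- by rewrite coef1.
- by rewrite coef0M p0 r0 mulr1.
- by rewrite coefB coef1 coef0M a0 mul0r subr0.
Qed.

Lemma garvan_den_coef0 (s : seq nat) : (garvan_den s)`_0 = 1.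
Proof.
rewrite /garvan_den !coef0M !qpoch_coef0 ?coefMX // !mulr1.
elim/big_ind: _ => [|p r p0 r0|j _]; first by rewrite coef1.
  by rewrite coef0M p0 r0 mulr1.
by rewrite qpoch_coef0 // coefX.
Qed.

(* N_k(m, n): the coefficient of x^m in that of q^n in the sum of the summands
   over all s of size k - 1.  By garvan_term_eq0 only those with entries at
   most n contribute. *)
Definition garvan_N (k : nat) (m : int) (n : nat) : int :=
  (\sum_(s : k.-1.-tuple 'I_n.+1 | sorted leq (map val s))
      fps_div (garvan_num (map val s)) (garvan_den (map val s)) n)@_m.

Lemma garvan_term_eq0 (s : seq nat) (n : nat) :
  has (fun i => n < i)%N s -> fps_div (garvan_num s) (garvan_den s) n = 0.
Proof.
move=> /hasP[i s_i lt_ni].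
rewrite /fps_div /garvan_num coefXnM; case: ifP => // /negP[].
rewrite (big_rem i) //=; apply: leq_trans lt_ni (leq_trans _ (leq_addr _ _)).
by rewrite -mulnn; case: i {s_i} => // i; rewrite leq_pmulr.
Qed.

(* Main.v *)
Require Import Defs.
From mathcomp Require Import all_boot all_order all_algebra.
From mathcomp Require Import ring zify.
From mathcomp.multinomials Require Import monalg.

(** Expanding 1 / ((1 - x t) (1 - x^-1 t)) in powers of t gives
    \sum_l chi_l t^l, where chi_l = x^l + x^(l-2) + ... + x^-l is a character
    of SU(2).  Products of the chi_l are sums of chi_l (Clebsch-Gordan), and
    1 / (1 - q^j) has natural coefficients, so the coefficient of q^n in each
    summand of the Garvan series is a sum of chi_l.  The coefficient of x^m in
    chi_l is at least that of x^(m+2) when m >= 0. *)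

Import GRing.Theory Num.Theory.

Local Open Scope ring_scope.

(* cheby s l is chi_l when s = x + x^-1. *)
Fixpoint cheby {R : comNzRingType} (s : R) (n : nat) : R :=
  match n with
  | 0 => 1
  | 1 => s
  | (n'.+1 as n1).+1 => s * cheby s n1 - cheby s n'
  end.

Section ChebyshevCone.
Set Implicit Arguments.
Unset Strict Implicit.
Variables (R : comNzRingType) (s : R).
Implicit Types (p q d : {poly R}) (f g : R).

Lemma chebySS n : cheby s n.+2 = s * cheby s n.+1 - cheby s n.
Proof. by []. Qed.

(** Both sides satisfy the Chebyshev recurrence in [n], so the cases [n = 0] and [n = 1] suffice.
    Lowering both indices at once gives Clebsch-Gordan with no subtraction. *)
Lemma cheby_mulSS m n :
  cheby s m.+1 * cheby s n.+1 = cheby s (m + n).+2 + cheby s m * cheby s n.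
Proof.
elim/ltn_ind: n => -[|[|n]] IHn.
- by rewrite addn0 chebySS /=; ring.
- by rewrite addn1 !chebySS /=; ring.
- rewrite (chebySS n.+1) mulrBr mulrCA !IHn // !addnS (chebySS (m + n).+2).
  by rewrite (chebySS n); ring.
Qed.

Inductive cheby_cone : R -> Prop :=
| cheby_cone0 : cheby_cone 0
| cheby_cone_cheby n : cheby_cone (cheby s n)
| cheby_coneD f g : cheby_cone f -> cheby_cone g -> cheby_cone (f + g).

Lemma cheby_cone_sum (I : Type) (r : seq I) (P : pred I) (F : I -> R) :
  (forall i, P i -> cheby_cone (F i)) -> cheby_cone (\sum_(i <- r | P i) F i).
Proof.
by move=> coneF; apply: big_ind => //; [exact: cheby_cone0|exact: cheby_coneD].
Qed.

Lemma cheby_coneM f g : cheby_cone f -> cheby_cone g -> cheby_cone (f * g).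
Proof.
move=> cone_f cone_g; elim: cone_f => [|m|f1 f2 _ IH1 _ IH2].
- by rewrite mul0r; exact: cheby_cone0.
- elim: cone_g => [|n|g1 g2 _ IH1 _ IH2].
  + by rewrite mulr0; exact: cheby_cone0.
  + elim: m n => [|m IHm] [|n]; rewrite ?mul1r ?mulr1;
      try exact: cheby_cone_cheby.
    by rewrite cheby_mulSS; apply: cheby_coneD (cheby_cone_cheby _) (IHm n).
  + by rewrite mulrDr; exact: cheby_coneD.
- by rewrite mulrDl; exact: cheby_coneD.
Qed.

Definition cheby_poly p := forall i, cheby_cone p`_i.

Lemma cheby_polyM p q : cheby_poly p -> cheby_poly q -> cheby_poly (p * q).
Proof.
move=> pp pq i; rewrite coefM.
by apply: cheby_cone_sum => j _; apply: cheby_coneM.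
Qed.

Lemma cheby_poly_sum (I : Type) (r : seq I) (P : pred I) (F : I -> {poly R}) :
  (forall i, P i -> cheby_poly (F i)) -> cheby_poly (\sum_(i <- r | P i) F i).
Proof.
by move=> PF i; rewrite coef_sum; apply: cheby_cone_sum => j /PF; exact.
Qed.

Lemma cheby_polyC f : cheby_cone f -> cheby_poly f%:P.
Proof.
by move=> cf i; rewrite coefC; case: eqP => // _; exact: cheby_cone0.
Qed.

Lemma cheby_polyXn n : cheby_poly 'X^n.
Proof.
move=> i; rewrite coefXn.
by case: eqP => _; [exact: (cheby_cone_cheby 0)|exact: cheby_cone0].
Qed.

(** The power series 1 / [d] has coefficients in the cone; polynomial inverses modulo each 'X^n
    stand in for the series. *)
Definition cheby_inv d := forall n, exists e u : {poly R},
  cheby_poly e /\ d * e = 1 + 'X^n * u.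

Lemma cheby_inv1 : cheby_inv 1.
Proof. by move=> n; exists 1, 0; split; [exact: (cheby_polyXn 0)|ring]. Qed.

Lemma cheby_invM d1 d2 : cheby_inv d1 -> cheby_inv d2 -> cheby_inv (d1 * d2).
Proof.
move=> inv1 inv2 n; have [e1 [u1 [pe1 de1]]] := inv1 n.
have [e2 [u2 [pe2 de2]]] := inv2 n.
exists (e1 * e2), (u1 + u2 + u1 * 'X^n * u2); split; first exact: cheby_polyM.
by rewrite mulrACA de1 de2; ring.
Qed.

Lemma cheby_inv_prod (I : Type) (r : seq I) (P : pred I) (F : I -> {poly R}) :
  (forall i, P i -> cheby_inv (F i)) -> cheby_inv (\prod_(i <- r | P i) F i).
Proof.
by move=> IF; apply: big_ind => //; [exact: cheby_inv1|exact: cheby_invM].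
Qed.

Lemma cheby_inv_1subXn j : cheby_inv (1 - 'X^(j.+1)).
Proof.
(* Truncated geometric series: the error 'X^((j+1)n) splits as 'X^n * 'X^(jn). *)
move=> n; exists (\sum_(i < n) 'X^(j.+1) ^+ i), (- 'X^(j * n)); split.
  by apply: cheby_poly_sum => i _; rewrite -exprM; exact: cheby_polyXn.
by rewrite -opprB mulNr -subrX1 -exprM mulSn exprD; ring.
Qed.

(** The recurrence makes the product telescope, leaving only the boundary terms of the truncated
    generating function. *)
Lemma cheby_gen_fun (t : {poly R}) n :
  (1 - s%:P * t + t ^+ 2) * \sum_(i < n.+1) (cheby s i)%:P * t ^+ i =
  1 - t ^+ n.+1 * ((cheby s n.+1)%:P - (cheby s n)%:P * t).
Proof.
elim: n => [|n IHn]; first by rewrite big_ord1 /=; ring.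
rewrite big_ord_recr mulrDr IHn chebySS polyCB polyCM !exprS /=; ring.
Qed.

Lemma cheby_inv_quadratic j :
  cheby_inv (1 - s%:P * 'X^(j.+1) + 'X^(j.+1) ^+ 2).
Proof.
move=> n; exists (\sum_(i < n.+1) (cheby s i)%:P * 'X^(j.+1) ^+ i).
exists (- ('X^(j * n) * 'X^(j.+1) *
           ((cheby s n.+1)%:P - (cheby s n)%:P * 'X^(j.+1)))).
split; last first.
  by rewrite cheby_gen_fun exprSr -exprM mulSn exprD; ring.
apply: cheby_poly_sum => i _; rewrite -exprM.
by apply: cheby_polyM (cheby_polyXn _); apply/cheby_polyC/cheby_cone_cheby.
Qed.

Lemma fps_div_cone p d n :
  d`_0 = 1 -> cheby_poly p -> cheby_inv d -> cheby_cone (fps_div p d n).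
Proof.
move=> d0 pp /(_ n.+1)[e [u [pe de]]].
rewrite /fps_div; set S := \sum_(i < _) _.
have dS : d * S = 1 - (1 - d) ^+ n.+1.
  by rewrite -[RHS]opprB subrX1 -/S; ring.
have high v : (v * (1 - d) ^+ n.+1)`_n = 0.
  by apply: coef_mul_exp => //; rewrite coefB coef1 d0 subrr.
(* Both [S] and [e] invert [d] modulo 'X^(n+1): computing [p * d * e * S] in two ways compares
   [p * S] with [p * e], and neither correction reaches degree [n]. *)
have pS : p * S = p * e - p * e * (1 - d) ^+ n.+1 - 'X^(n.+1) * (p * u * S).
  transitivity (p * (d * e) * S - 'X^(n.+1) * (p * u * S)).
    by rewrite de; ring.
  have -> : p * (d * e) * S = p * e * (d * S) by ring.
  by rewrite dS; ring.
by rewrite pS !coefB high coefXnM ltnSn !subr0; exact: cheby_polyM.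
Qed.

End ChebyshevCone.

Lemma mcoeff_lXM i (f : laurent) m : (lX i * f)@_m = f@_(m - i).
Proof.
elim/laurent_ind: f => [|c j|f g IHf IHg].
- by rewrite mulr0 !mcoeff0.
- rewrite [lX i * _]lmulUU !mcoeffU mul1r; congr (_ *+ nat_of_bool _).
  by apply/eqP/eqP; lia.
- by rewrite mulrDr !mcoeffD IHf IHg.
Qed.

(* The coefficients of (1 - x^-2) chi_n = x^n - x^(-n-2). *)
Lemma cheby_lX_diff n (m : int) :
  (cheby (lX 1 + lX (-1)) n)@_m - (cheby (lX 1 + lX (-1)) n)@_(m + 2) =
  (m == n%:Z)%:Z - (m == - n%:Z - 2)%:Z.
Proof.
elim/ltn_ind: n m => -[|[|n]] IHn m.
- by rewrite /= !mcoeffU !natz; lia.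
- by rewrite /= !mcoeffD !mcoeffU !natz; lia.
- pose c k j : int := (cheby (lX 1 + lX (-1)) k)@_j.
  (* Multiplication by x + x^-1 adds the two neighbouring coefficients, so the claim for [n.+2] is a
     linear combination of earlier instances. *)
  have cSS j : c n.+2 j = c n.+1 (j - 1) + c n.+1 (j + 1) - c n j.
    by rewrite /c chebySS mulrDl mcoeffB mcoeffD !mcoeff_lXM opprK.
  have cD k j : (k < n.+2)%N ->
      c k j - c k (j + 2) = (j == k%:Z)%:Z - (j == - k%:Z - 2)%:Z.
    by move=> lt_k; exact: IHn.
  rewrite -[LHS]/(c n.+2 m - c n.+2 (m + 2)) !cSS
    (addrAC m 2 (-1)) (addrAC m 2 1).
  have := cD n.+1 (m - 1) (ltnSn _); have := cD n.+1 (m + 1) (ltnSn _).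
  have := cD n m (leqnSn _).
  move: (c n m) (c n (m + 2)) (c n.+1 _) (c n.+1 _) (c n.+1 _) (c n.+1 _).
  lia.
Qed.

Lemma cheby_cone_mcoeff (f : laurent) (m : nat) :
  cheby_cone (lX 1 + lX (-1)) f -> f@_(m%:Z + 2) <= f@_m%:Z.
Proof.
elim=> [|n|g h _ IHg _ IHh].
- by rewrite !mcoeff0.
(* As [m] is nonnegative, it cannot equal - n - 2, so the negative term vanishes. *)
- by have := cheby_lX_diff n m%:Z; lia.
- by rewrite !mcoeffD lerD.
Qed.

Lemma garvan_den_inv (s : seq nat) :
  cheby_inv (lX 1 + lX (-1)) (garvan_den s).
Proof.
rewrite /garvan_den -mulrA; apply: cheby_invM.
  apply: cheby_inv_prod => i _; apply: cheby_inv_prod => j _.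
  by rewrite -exprS; exact: cheby_inv_1subXn.
(* The factors in x and x^-1 are paired for each [j]: alone, neither has an inverse symmetric under
   exchanging x and x^-1, while their product is the quadratic of [cheby_inv_quadratic]. *)
rewrite /qpoch -big_split /=; apply: cheby_inv_prod => j _.
have lX11 : (lX 1)%:P * (lX (-1))%:P = 1 :> {poly laurent}.
  by rewrite -polyCM [lX 1 * _]lmulUU mul1r.
rewrite -!(mulrA _%:P) -exprS.
have factor (a b t : {poly laurent}) : a * b = 1 ->
    (1 - a * t) * (1 - b * t) = 1 - (a + b) * t + t ^+ 2.
  by move=> ab1; ring: ab1.
by rewrite factor // -polyCD; exact: cheby_inv_quadratic.
Qed.

Theorem theorem4p1 (k : nat) (hk : (2 <= k)%N) (m n : nat) :
  garvan_N k (m%:Z + 2) n <= garvan_N k m%:Z n.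
Proof.
apply: cheby_cone_mcoeff; apply: cheby_cone_sum => s _.
apply: fps_div_cone (garvan_den_coef0 _) _ (garvan_den_inv _).
exact: cheby_polyXn.
Qed.
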